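(* Let $n\in\mathbb{N}=\{1,2,\ldots\}$ and let $x$ be real with $|x|<1$. Then $$\mathfrak{E}_{n-1}(2x,1)=\frac{S_n\big(x,\sqrt{1-x^2}\big)}{\sqrt{1-x^2}}=\frac{1}{\sqrt{1-x^2}}\,\mathrm{Im}\big\{N_n\big(x+i\sqrt{1-x^2}\big)\big\}.$$
   Context: The Dickson polynomials of the second kind $\mathfrak{E}_n(x,\alpha)$ ($\alpha$ a real parameter) are given by $\frac{1}{1-xt+\alpha t^2}=\sum_{n\ge0}\mathfrak{E}_n(x,\alpha)t^n$. The polynomials $S_n(x,y)$ are defined by $e^{xt}\sin(yt)=\sum_{n\ge0}S_n(x,y)\frac{t^n}{n!}$. For $w=x+iy$ with $x,y\in\mathbb{R}$, also written $(x,y)$, the polynomials $N_n(w)$ are defined by $\exp(wt)=\sum_{n\ge0}N_n(w)\frac{t^n}{n!}$. *)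

(* Defs.v *)
From Stdlib Require Import Reals Factorial.
From Coquelicot Require Import Coquelicot.
Local Open Scope R_scope.

(* The expansion of the rational function 1 / (1 - x t + a t^2) is only
   required for t near 0, its radius of convergence depending on x and a. *)
Definition is_dickson2 (E : nat -> R -> R -> R) : Prop :=
  forall x a : R,
    locally 0 (fun t : R =>
      is_pseries (fun n => E n x a) t (1 / (1 - x * t + a * t ^ 2))).

Definition is_sine_poly (S : nat -> R -> R -> R) : Prop :=
  forall x y t : R,
    is_pseries (fun n => S n x y / INR (fact n)) t (exp (x * t) * sin (y * t)).

(* Coquelicot has no complex exponential. *)
Definition Cexp (z : C) : C := (exp (Re z) * cos (Im z), exp (Re z) * sin (Im z)).

(* A power series in the real variable t with coefficients in C, seen as a
   real normed module. *)
Definition is_exp_poly (N : nat -> C -> C) : Prop :=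
  forall (w : C) (t : R),
    @is_pseries R_AbsRing C_R_NormedModule
      (fun n => (N n w / RtoC (INR (fact n)))%C) t (Cexp (w * RtoC t)%C).

(* Main.v *)
(** Put w = x + i y with y = sqrt (1 - x^2).  The n-th derivative at 0 of
    t |-> e^(xt) sin (yt) is Im (w^n), so S_n(x, y) = Im (w^n) = Im (N_n(w)).
    As |w| = 1, w is a root of z^2 - 2 x z + 1, hence Im (w^n) satisfies the
    three-term recurrence that 1 / (1 - 2 x t + t^2) imposes on the Dickson
    polynomials E_n(2x, 1). *)

Require Import Defs.
From Corelib Require Import ssreflect.
From Stdlib Require Import Reals Lra Lia Factorial.
From Coquelicot Require Import Coquelicot.
Local Open Scope R_scope.

(** Beyond the radius of convergence the terms of the series do not tend to 0, whereas those of a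
    convergent series do. *)
Lemma CV_radius_ge_of_ex_pseries (a : nat -> R) (r : R) :
  ex_pseries a r -> Rbar_le (Rabs r) (CV_radius a).
Proof.
  intros Ha.
  apply Rbar_not_lt_le; intros Hlt.
  apply (CV_disk_outside a r Hlt).
  apply ex_series_lim_0.
  now apply ex_pseries_R.
Qed.

(** Used to read off coefficients from a generating function known only near 0. *)
Lemma Derive_n_of_is_pseries (a : nat -> R) (f : R -> R) (n : nat) :
  locally 0 (fun t => is_pseries a t (f t)) ->
  Derive_n f n 0 = a n * INR (fact n).
Proof.
  intros Ha.
  rewrite <- Derive_n_coef.
  - apply Derive_n_ext_loc.
    apply: filter_imp Ha => t Ht.
    symmetry; now apply is_pseries_unique.
  - destruct Ha as [d Hd].
    (* Convergence at the single point [d / 2] of the neighbourhood already makes the radius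
       positive, as [Derive_n_coef] requires. *)
    assert (Hd2 : 0 < d / 2) by (pose proof (cond_pos d); lra).
    apply Rbar_lt_le_trans with (Rabs (d / 2)).
    + simpl; rewrite Rabs_pos_eq; lra.
    + apply CV_radius_ge_of_ex_pseries.
      exists (f (d / 2)); apply Hd.
      rewrite /ball /= /AbsRing_ball /abs /minus /plus /opp /=.
      rewrite Rabs_pos_eq; pose proof (cond_pos d); lra.
Qed.

(** With w = x + i y the function is Im (e^(wt)), and the value given is Im (w^n e^(wt)) written out
    in real terms. *)
Lemma is_derive_n_exp_trig (x y : R) (n : nat) (t : R) :
  is_derive_n (fun t => exp (x * t) * sin (y * t)) n t
    (exp (x * t) * (Re ((x, y) ^ n)%C * sin (y * t) +
                    Im ((x, y) ^ n)%C * cos (y * t))).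
Proof.
  revert t; induction n as [|n IH]; intros t.
  - simpl; ring.
  - simpl.
    apply is_derive_ext with (fun t => exp (x * t) *
      (Re ((x, y) ^ n)%C * sin (y * t) + Im ((x, y) ^ n)%C * cos (y * t))).
    + intros u; symmetry; apply is_derive_n_unique, IH.
    + destruct ((x, y) ^ n)%C as [p q]; simpl.
      auto_derive; [trivial | ring].
Qed.

Lemma sine_poly_Im_pow (S : nat -> R -> R -> R) (hS : is_sine_poly S)
    (n : nat) (x y : R) : S n x y = Im ((x, y) ^ n)%C.
Proof.
  assert (H := Derive_n_of_is_pseries _ _ n
                 (filter_forall _ (fun t => hS x y t))).
  rewrite (is_derive_n_unique _ _ _ _ (is_derive_n_exp_trig x y n 0)) in H.
  rewrite !Rmult_0_r exp_0 sin_0 cos_0 in H.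
  pose proof (INR_fact_neq_0 n).
  field_simplify in H; [lra | assumption].
Qed.

(** As t is real, [snd] commutes with the partial sums; being continuous, it also commutes with
    their limit. *)
Lemma is_pseries_snd (a : nat -> C) (t : R) (l : C) :
  @is_pseries R_AbsRing C_R_NormedModule a t l ->
  is_pseries (fun n => snd (a n)) t (snd l).
Proof.
  intros Ha.
  apply filterlim_ext with (fun n => snd
    (@sum_n C_R_NormedModule (fun k => scal (pow_n t k) (a k)) n)).
  - intros n; induction n as [|n IH].
    + now rewrite !sum_O.
    + now rewrite !sum_Sn -IH.
  - apply: filterlim_comp Ha _.
    apply (continuous_snd (U := R_UniformSpace) (V := R_UniformSpace)).
Qed.

(** This lets [sine_poly_Im_pow] serve for N as well, so that N_n(w) = w^n need not be proved. *)
Lemma is_sine_poly_Im_exp_poly (N : nat -> C -> C) (hN : is_exp_poly N) :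
  is_sine_poly (fun n x y => Im (N n (x, y))).
Proof.
  intros x y t.
  replace (exp (x * t) * sin (y * t)) with (snd (Cexp ((x, y) * RtoC t)%C)).
  - apply is_pseries_ext with (2 := is_pseries_snd _ _ _ (hN (x, y) t)).
    intros n; unfold Cdiv, Cmult, Cinv, Im; simpl.
    pose proof (INR_fact_neq_0 n); field; trivial.
  - simpl; f_equal; f_equal; ring.
Qed.

Lemma dickson2_denominator_neq_0 (x a : R) :
  locally 0 (fun t => 1 - x * t + a * t ^ 2 <> 0).
Proof.
  assert (Hc : continuous (fun t => 1 - x * t + a * t ^ 2) 0).
  { apply: ex_derive_continuous; auto_derive; trivial. }
  apply (Hc (fun u => u <> 0)), open_neq; simpl; lra.
Qed.

Lemma dickson2_recurrence (E : nat -> R -> R -> R) (hE : is_dickson2 E)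
    (x a : R) :
  E 0%nat x a = 1 /\ E 1%nat x a = x /\
  forall n, E (S (S n)) x a = x * E (S n) x a - a * E n x a.
Proof.
  set (e := fun n => E n x a).
  (* The coefficients of (1 - x t + a t^2) times the series of the E_n; this product is the constant
     1 near 0. *)
  set (c := PS_plus e (PS_plus (PS_scal (- x) (PS_incr_1 e))
                               (PS_scal a (PS_incr_1 (PS_incr_1 e))))).
  assert (Hc : locally 0 (fun t => is_pseries c t ((fun _ => 1) t))).
  { generalize (filter_and _ _ (hE x a) (dickson2_denominator_neq_0 x a)).
    apply: filter_imp => t [Ht Hnz].
    set (F := 1 / (1 - x * t + a * t ^ 2)) in Ht.
    assert (H1 := is_pseries_incr_1 _ _ _ Ht).
    assert (H2 := is_pseries_incr_1 _ _ _ H1).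
    assert (Hsum := is_pseries_plus _ _ _ _ _ Ht (is_pseries_plus _ _ _ _ _
      (is_pseries_scal (- x) _ _ _ (Rmult_comm _ _) H1)
      (is_pseries_scal a _ _ _ (Rmult_comm _ _) H2))).
    match type of Hsum with is_pseries _ _ ?s => replace 1 with s end;
      [exact Hsum |].
    rewrite /plus /scal /= /mult /= /F; field; exact Hnz. }
  assert (Hcoef : forall n, c n * INR (fact n) =
    match n with O => 1 | S _ => 0 end).
  { intros n; rewrite -(Derive_n_of_is_pseries c (fun _ => 1) n Hc).
    destruct n; [reflexivity | apply Derive_n_const]. }
  assert (Hc0 : forall n, c (S n) = 0).
  { intros n; specialize (Hcoef (S n)).
    apply Rmult_integral in Hcoef.
    destruct Hcoef as [|H]; [trivial | now apply INR_fact_neq_0 in H]. }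
  assert (H0 := Hcoef 0%nat); assert (H1 := Hc0 0%nat).
  rewrite /c /PS_plus /PS_scal /plus /scal /zero /= /mult /zero /= in H0, H1.
  unfold e in H0, H1; simpl in H0, H1.
  assert (E0 : E 0%nat x a = 1) by lra.
  rewrite E0 in H1.
  split; [exact E0 | split; [lra |]].
  intros n; assert (H2 := Hc0 (S n)).
  rewrite /c /PS_plus /PS_scal /plus /scal /= /mult /= /e in H2.
  lra.
Qed.

(** The factor y stays on the left, so y = 0 needs no exclusion. Since the recurrence has order two,
    the induction carries two consecutive indices. *)
Lemma dickson2_Im_pow (E : nat -> R -> R -> R) (hE : is_dickson2 E)
    (x y : R) (hxy : x ^ 2 + y ^ 2 = 1) (n : nat) :
  y * E n (2 * x) 1 = Im ((x, y) ^ S n)%C.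
Proof.
  destruct (dickson2_recurrence E hE (2 * x) 1) as (E0 & E1 & ES).
  enough (H : y * E n (2 * x) 1 = Im ((x, y) ^ S n)%C /\
              y * E (S n) (2 * x) 1 = Im ((x, y) ^ S (S n))%C) by apply H.
  induction n as [|n [IH0 IH1]].
  - rewrite E0 E1; simpl; split; ring.
  - split; [exact IH1 |].
    replace (y * E (S (S n)) (2 * x) 1) with
      (2 * x * (y * E (S n) (2 * x) 1) - y * E n (2 * x) 1)
      by (rewrite ES; ring).
    rewrite IH0 IH1 !(Cpow_S _ (S _)).
    destruct ((x, y) ^ S n)%C as [p q]; simpl.
    (* Here |w| = 1 enters: writing q as |w|^2 q turns the goal into a polynomial identity, namely
       w^2 = 2 x w - |w|^2 applied to p + i q. *)
    replace (2 * x * (x * q + y * p) - q) with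
      (2 * x * (x * q + y * p) - (x ^ 2 + y ^ 2) * q)
      by (rewrite hxy; ring).
    ring.
Qed.

Theorem corollary36 (E S : nat -> R -> R -> R) (N : nat -> C -> C)
    (hE : is_dickson2 E) (hS : is_sine_poly S) (hN : is_exp_poly N)
    (n : nat) (hn : (1 <= n)%nat) (x : R) (hx : Rabs x < 1) :
  E (n - 1)%nat (2 * x) 1 = S n x (sqrt (1 - x ^ 2)) / sqrt (1 - x ^ 2) /\
  S n x (sqrt (1 - x ^ 2)) / sqrt (1 - x ^ 2) =
    1 / sqrt (1 - x ^ 2) *
      Im (N n (RtoC x + Ci * RtoC (sqrt (1 - x ^ 2)))%C).
Proof.
  assert (Hpos : 0 < 1 - x ^ 2) by (apply Rabs_def2 in hx; nra).
  assert (Hy : 0 < sqrt (1 - x ^ 2)) by now apply sqrt_lt_R0.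
  assert (Hxy : x ^ 2 + sqrt (1 - x ^ 2) ^ 2 = 1)
    by (rewrite pow2_sqrt; lra).
  set (y := sqrt (1 - x ^ 2)) in *.
  replace (RtoC x + Ci * RtoC y)%C with (x, y)
    by (unfold Cplus, Cmult; simpl; f_equal; ring).
  (* Both Im (N_n(w)) and S_n(x, y) become Im (w^n), and division by y > 0 then gives E_{n-1}. *)
  rewrite (sine_poly_Im_pow _ (is_sine_poly_Im_exp_poly N hN) n x y).
  rewrite (sine_poly_Im_pow S hS).
  split; [| field; lra].
  destruct n as [|n]; [lia |].
  rewrite -(dickson2_Im_pow E hE x y Hxy) Nat.sub_succ Nat.sub_0_r.
  field; lra.
Qed.
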